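(* Let $2\leq k\leq m\leq n$ be integers and let $A$ be a nonnegative matrix of size $m\times n$ with $|A|_{\infty}\leq 1$. Then $$\|A\|_{*k}+\|J_{m,n}-A\|_{*k}\leq\sqrt{mn}\left(1+\sqrt{k-1}\right).$$
   Context: Matrices are real, and nonnegative means entrywise nonnegative. $J_{m,n}$ is the $m\times n$ all-ones matrix. $|A|_{\infty}$ is the maximum of the absolute values of the entries of $A$. $\sigma_1(A)\geq\sigma_2(A)\geq\cdots$ denote the singular values of $A$ in nonincreasing order, and the Ky Fan $k$-norm of $A$ is $\|A\|_{*k}=\sigma_1(A)+\cdots+\sigma_k(A)$. *)

(* Defs.v *)
From HB Require Import structures.
From mathcomp Require Import all_boot all_order all_algebra.
From mathcomp Require Import polyrcf.
From mathcomp Require Import reals normedtype.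

Set Implicit Arguments.
Unset Strict Implicit.
Unset Printing Implicit Defensive.

Import Order.TTheory GRing.Theory Num.Theory.
Local Open Scope ring_scope.

(* [rootsR p] is the list of distinct roots of p, and [mup x p] is the
   multiplicity of x; so each real eigenvalue of M is listed as many times as
   its algebraic multiplicity. When M is symmetric, no eigenvalue is missed. *)
Definition eigenvalue_seq (R : rcfType) (n : nat) (M : 'M[R]_n) : seq R :=
  flatten [seq nseq (mup x (char_poly M)) x | x <- rootsR (char_poly M)].

(* For A of size m x n this list has n entries: when m < n, it is the usual list
   of min(m, n) singular values followed by n - m zeros. *)
Definition singular_values (R : rcfType) (m n : nat) (A : 'M[R]_(m, n)) :
    seq R :=
  sort >=%R [seq Num.sqrt a | a <- eigenvalue_seq (A^T *m A)].

(* Indices start at 0: the i-th entry is sigma_(i+1)(A). *)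
Definition ky_fan_norm (R : rcfType) (k m n : nat) (A : 'M[R]_(m, n)) : R :=
  \sum_(i < k) (singular_values A)`_i.

(* Main.v *)
Require Import Defs.
From mathcomp Require Import all_boot all_order all_algebra.
From mathcomp Require Import polyrcf complex sesquilinear spectral.
From mathcomp Require Import ring lra.
From mathcomp Require Import reals normedtype.

Set Implicit Arguments.
Unset Strict Implicit.
Unset Printing Implicit Defensive.

Import Order.TTheory GRing.Theory Num.Theory.
Local Open Scope ring_scope.
Local Open Scope sesquilinear_scope.

(** Put B = J - A, N = sqrt (m n), c = sqrt (k - 1), and let x, y be the largest
    singular values of A and B. The k - 1 other terms of each Ky Fan norm are
    bounded by the squared Frobenius norm that the largest singular value leaves
    over. By the inequality of arithmetic and geometric means with weight
    t = c / N, each of them satisfies s <= t s^2 + 1 / (4 t), so that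
      ||A||_k <= x + (c / N) (|A|_F^2 - x^2) + c N / 4,
    and likewise for B ([ky_fan_norm_le]).

    Since the entries of A lie in [0, 1], a^2 + (1 - a)^2 <= 1 entrywise and
    |A|_F^2 + |B|_F^2 <= N^2. Since the entries of A and B add up to m n = N^2,
    and N times the largest singular value of a matrix is at least the sum of its
    entries ([sum_entries_le]), x + y >= N. Now x^2 + y^2 >= (x + y)^2 / 2, and
    with u = x + y the bound follows from N (u - N) <= c (u^2 - N^2) / 2. This
    holds because u >= N, and because c >= 1 when k >= 2.
    Equality forces x = y = N / 2 and makes the other k - 1 terms of each norm
    equal to N / (2 c), which is why the weight c / N is the right one.

    The two facts on singular values, that their squares add up to |A|_F^2 and
    that the largest one bounds the quadratic form of A^T A, come from the
    diagonalization of the symmetric matrix A^T A. It is obtained over the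
    complex numbers, where a Hermitian matrix is unitarily diagonalizable with
    real eigenvalues, and its consequences are brought back to the real field
    ([real_symmetric_eigenvalues]). *)

(** * Eigenvalues of real symmetric matrices *)

Lemma char_poly_conjugate (K : fieldType) n (P D : 'M[K]_n) :
  P \in unitmx -> char_poly (invmx P *m D *m P) = char_poly D.
Proof.
move=> Pu; rewrite /char_poly.
have -> : char_poly_mx (invmx P *m D *m P)
    = map_mx polyC (invmx P) *m char_poly_mx D *m map_mx polyC P.
  rewrite /char_poly_mx mulmxBr mulmxBl -scalemx1 -scalemxAr -scalemxAl mulmx1.
  by rewrite -map_mxM mulVmx // map_mx1 !map_mxM.
rewrite !det_mulmx mulrAC -det_mulmx -map_mxM mulVmx //.
by rewrite map_mx1 det1 mul1r.
Qed.

Lemma perm_eigenvalue_seq (R : rcfType) n (M : 'M[R]_n) (s : seq R) :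
  char_poly M = \prod_(x <- s) ('X - x%:P) -> perm_eq (eigenvalue_seq M) s.
Proof.
move=> chM; rewrite /eigenvalue_seq.
have rootsE : perm_eq (rootsR (char_poly M)) (undup s).
  apply: uniq_perm; rewrite ?undup_uniq ?uniq_roots // => x.
  have := roots_on_rootsR (monic_neq0 (char_poly_monic M)) x.
  by rewrite inE /= => <-; rewrite mem_undup chM root_prod_XsubC.
apply: perm_trans (perm_count_undup s).
apply/perm_flatten/(perm_trans (perm_map _ rootsE)).
by under eq_map => x do rewrite chM mu_prod_XsubC.
Qed.

(** Over the complex extension a real symmetric matrix is Hermitian, hence
    unitarily diagonalizable with a real diagonal. *)
Lemma real_symmetric_spectral (R : rcfType) n (M : 'M[R]_n) : M^T = M ->
  exists2 U : 'M[complex R]_n, U \is unitarymx &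
  exists d : 'rV[R]_n, map_mx (real_complex R) M
    = invmx U *m diag_mx (map_mx (real_complex R) d) *m U.
Proof.
move=> Msym; set MC := map_mx _ M.
have MCreal : MC \is a realmx.
  by apply/mxOverP => i j; rewrite mxE complex_real.
have MCherm : MC \is hermsymmx.
  apply: realsym_hermsym => //; apply/is_hermitianmxP.
  by rewrite expr0 scale1r map_mx_id // /MC map_trmx Msym.
exists (spectralmx MC); first exact: spectral_unitarymx.
have /mxOverP dreal := hermitian_spectral_diag_real MCherm.
exists (map_mx (@complex.Re R) (spectral_diag MC)).
rewrite -map_mx_comp (_ : map_mx _ (spectral_diag MC) = spectral_diag MC).
  exact/orthomx_spectralP/hermitian_normalmx.
by apply/matrixP => i j; rewrite mxE /= RRe_real.
Qed.

(** If U is the unitary matrix of the diagonalization and w = U u, then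
    u^T M u = sum_i d_i |w_i|^2 and u^T u = sum_i |w_i|^2, which gives the bound
    on the quadratic form. *)
Lemma real_symmetric_eigenvalues (R : rcfType) n (M : 'M[R]_n) : M^T = M ->
  exists d : 'rV[R]_n,
  [/\ perm_eq (eigenvalue_seq M) [seq d 0 i | i <- enum 'I_n],
      \tr M = \sum_i d 0 i &
      forall (c : R) (u : 'cV[R]_n), (forall i, d 0 i <= c) ->
        (u^T *m M *m u) 0 0 <= c * (u^T *m u) 0 0].
Proof.
move=> /real_symmetric_spectral[U Uunitary [d Mdiag]]; exists d.
have Uunit := unitarymx_unit Uunitary; split=> [||c u dlec].
- apply: perm_eigenvalue_seq; apply: (map_poly_inj (real_complex R)).
  rewrite map_char_poly Mdiag char_poly_conjugate // char_poly_trig; last first.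
    exact/diag_mx_is_trig.
  rewrite rmorph_prod big_map big_enum /=; apply: eq_bigr => i _.
  by rewrite rmorphB /= map_polyX map_polyC /= !mxE eqxx.
- apply: (@complexI R).
  rewrite -trace_map_mx Mdiag mxtrace_mulC mulmxA mulmxV // mul1mx.
  by rewrite mxtrace_diag rmorph_sum; apply: eq_bigr => i _; rewrite mxE.
set f := real_complex R; pose v := map_mx f u; pose w := U *m v.
have vT : v^T = v ^t*.
  by apply/matrixP => i j; rewrite !mxE; apply/esym/CrealP; rewrite complex_real.
have wE : w ^t* = v^T *m invmx U.
  by rewrite trmx_mul map_mxM /= -vT invmx_unitary.
have sqrw (N : 'rV[complex R]_n) :
    (w ^t* *m diag_mx N *m w) 0 0 = \sum_i N 0 i * `|w i 0| ^+ 2.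
  rewrite mxE; apply: eq_bigr => i _; rewrite mul_mx_diag !mxE.
  by rewrite normCK; ring.
have uMu : f ((u^T *m M *m u) 0 0)
    = (w ^t* *m diag_mx (map_mx f d) *m w) 0 0.
  transitivity (map_mx f (u^T *m M *m u) 0 0); first by rewrite [RHS]mxE.
  by rewrite !map_mxM -map_trmx Mdiag wE !mulmxA.
have uu : f ((u^T *m u) 0 0) = (w ^t* *m diag_mx (const_mx 1) *m w) 0 0.
  transitivity (map_mx f (u^T *m u) 0 0); first by rewrite [RHS]mxE.
  by rewrite map_mxM -map_trmx diag_const_mx mulmx1 wE /w mulmxA mulmxKV.
rewrite -lecR rmorphM /= -/f uMu uu !sqrw mulr_sumr; apply: ler_sum => i _.
by rewrite !mxE mul1r ler_wpM2r ?exprn_ge0 // lecR.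
Qed.

(** If v is a real eigenvector for a, then a |v|^2 = |A v|^2. *)
Lemma gram_eigenvalue_ge0 (R : rcfType) m n (A : 'M[R]_(m, n)) a :
  a \in eigenvalue_seq (A^T *m A) -> 0 <= a.
Proof.
have sqnormE p (w : 'rV[R]_p) : (w *m w^T) 0 0 = \sum_i w 0 i ^+ 2.
  by rewrite mxE; apply: eq_bigr => i _; rewrite mxE expr2.
case/flatten_mapP => x xroot /nseqP[-> _] {a}.
have := roots_on_rootsR (monic_neq0 (char_poly_monic (A^T *m A))) x.
rewrite inE xroot /= -eigenvalue_root_char => /eigenvalueP[v vE v0].
have : x * (v *m v^T) 0 0 = (v *m A^T *m (v *m A^T)^T) 0 0.
  have -> : x * (v *m v^T) 0 0 = ((x *: v) *m v^T) 0 0.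
    by rewrite -scalemxAl [RHS]mxE.
  by rewrite -vE trmx_mul trmxK !mulmxA.
rewrite !sqnormE => eqx.
have v_gt0 : 0 < \sum_i v 0 i ^+ 2.
  rewrite lt_def sumr_ge0 ?andbT => [|i _]; last exact: sqr_ge0.
  apply: contraNneq v0 => /eqP.
  rewrite psumr_eq0 => [/allP/= vi0|i _]; last exact: sqr_ge0.
  apply/eqP/rowP => i; rewrite mxE; apply/eqP.
  by rewrite -sqrf_eq0 vi0 // mem_index_enum.
by rewrite -(pmulr_lge0 _ v_gt0) eqx sumr_ge0 // => i _; exact: sqr_ge0.
Qed.

(** * Singular values *)

Lemma singular_values_ge0 (R : rcfType) m n (A : 'M[R]_(m, n)) i :
  0 <= (singular_values A)`_i.
Proof.
have [/(mem_nth 0)|?] := ltnP i (size (singular_values A)).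
  by rewrite mem_sort => /mapP[y _ ->]; exact: sqrtr_ge0.
by rewrite nth_default.
Qed.

Lemma le_singular_values0 (R : rcfType) m n (A : 'M[R]_(m, n)) x :
  x \in singular_values A -> x <= (singular_values A)`_0.
Proof.
move=> /[dup] lti /(nth_index 0) <-; rewrite -index_mem in lti.
have sorteds : sorted >=%R (singular_values A).
  by apply: sort_sorted => y z; rewrite le_total.
have ge_trans : transitive (>=%R : rel R).
  by move=> y z w /[swap]; exact: le_trans.
have := sorted_leq_nth ge_trans lexx 0 sorteds.
by apply=> //; rewrite inE (leq_ltn_trans _ lti).
Qed.

(** Because the eigenvalues of A^T A are nonnegative, squaring a singular value
    recovers the eigenvalue; the last two claims are then the trace and the
    quadratic form of A^T A. *)
Lemma singular_values_spec (R : rcfType) m n (A : 'M[R]_(m, n)) :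
  [/\ size (singular_values A) = n,
      \sum_(x <- singular_values A) x ^+ 2 = \sum_i \sum_j A i j ^+ 2 &
      forall u : 'cV[R]_n, (u^T *m (A^T *m A) *m u) 0 0
        <= (singular_values A)`_0 ^+ 2 * (u^T *m u) 0 0].
Proof.
have Gsym : (A^T *m A)^T = A^T *m A by rewrite trmx_mul trmxK.
have [d [permd trd quadd]] := real_symmetric_eigenvalues Gsym.
have perms : perm_eq (singular_values A)
    [seq Num.sqrt x | x <- [seq d 0 i | i <- enum 'I_n]].
  by rewrite (perm_trans (permEl (perm_sort _ _))) // perm_map.
have dE i : Num.sqrt (d 0 i) ^+ 2 = d 0 i.
  rewrite sqr_sqrtr // (@gram_eigenvalue_ge0 _ _ _ A) // (perm_mem permd).
  by rewrite map_f // mem_enum.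
have sizes : size (singular_values A) = n.
  by rewrite (perm_size perms) 2!size_map size_enum_ord.
split=> // [|u].
  rewrite (perm_big _ perms) /= 2!big_map big_enum /=.
  under eq_bigr => i _ do rewrite dE.
  rewrite -trd exchange_big; apply: eq_bigr => j _; rewrite mxE.
  by apply: eq_bigr => i _; rewrite mxE expr2.
apply: quadd => i; rewrite -dE.
have : Num.sqrt (d 0 i) \in singular_values A.
  by rewrite (perm_mem perms) !map_f // mem_enum.
move=> /le_singular_values0 le_top.
by rewrite ler_sqr ?nnegrE ?sqrtr_ge0 ?singular_values_ge0.
Qed.

(** Each s among the k singular values after the first satisfies
    s <= t s^2 + 1 / (4 t), and their squares add up to at most
    |A|_F^2 - sigma_1^2. The parameter t is left free: its best value depends on
    how the squares are distributed. *)
Lemma ky_fan_norm_le (R : rcfType) k m n (A : 'M[R]_(m, n)) (t : R) :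
  (k < n)%N -> 0 < t ->
  ky_fan_norm k.+1 A <= (singular_values A)`_0
    + (t * (\sum_i \sum_j A i j ^+ 2 - (singular_values A)`_0 ^+ 2)
       + k%:R / (4 * t)).
Proof.
move=> ltkn t_gt0; have [sizes <- _] := singular_values_spec A.
set s := singular_values A in sizes *.
rewrite /ky_fan_norm big_ord_recl lerD2l.
have tail : \sum_(i < k) s`_i.+1 ^+ 2 <= \sum_(x <- s) x ^+ 2 - s`_0 ^+ 2.
  rewrite (big_nth 0) sizes big_mkord; case: n => // n in A s ltkn sizes *.
  rewrite big_ord_recl addrC addKr.
  rewrite -!(big_mkord xpredT (fun i => s`_i.+1 ^+ 2)).
  rewrite (@big_cat_nat _ _ _ k 0 n) //= lerDl.
  by apply: sumr_ge0 => i _; exact: sqr_ge0.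
have amgm (x : R) : x <= t * x ^+ 2 + (4 * t)^-1.
  rewrite -subr_ge0 (_ : _ - _ = t * (x - (2 * t)^-1) ^+ 2); last first.
    by field; lra.
  by rewrite mulr_ge0 ?sqr_ge0 // ltW.
apply: le_trans (ler_sum _ (fun i _ => amgm _)) _.
rewrite big_split /= -mulr_sumr sumr_const card_ord.
by rewrite -[_ *+ k]mulr_natl lerD2r ler_wpM2l // ltW.
Qed.

(** The variance of the family r is nonnegative; summing (m r_i - s)^2 avoids
    the division by m. *)
Lemma sqr_sum_le (R : realFieldType) m (r : 'I_m -> R) :
  (\sum_i r i) ^+ 2 <= m%:R * \sum_i r i ^+ 2.
Proof.
case: m r => [|m] r; first by rewrite big_ord0 expr0n mul0r.
set s := \sum_i r i; set p := m.+1.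
have var : \sum_i (p%:R * r i - s) ^+ 2
    = p%:R * (p%:R * \sum_i r i ^+ 2 - s ^+ 2).
  transitivity (\sum_i (p%:R ^+ 2 * r i ^+ 2 - 2 * p%:R * s * r i + s ^+ 2)).
    by apply: eq_bigr => i _; ring.
  rewrite big_split sumrB /= -!mulr_sumr sumr_const card_ord.
  by rewrite -[s *+ _]mulr_natl -/s -/p; ring.
rewrite -subr_ge0 -(pmulr_rge0 _ (_ : 0 < p%:R)) ?ltr0n // -var.
by apply: sumr_ge0 => i _; exact: sqr_ge0.
Qed.

(** For the all-ones column u, the vector A u lists the row sums of A, so the
    bound on the quadratic form of A^T A at u is
    sum_i r_i^2 <= sigma_1^2 n, where r_i is the sum of row i. The sum of the
    r_i is then bounded by the Cauchy-Schwarz inequality. *)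
Lemma sum_entries_le (R : rcfType) m n (A : 'M[R]_(m, n)) :
  (\sum_i \sum_j A i j) ^+ 2
    <= m%:R * n%:R * (singular_values A)`_0 ^+ 2.
Proof.
pose u : 'cV[R]_n := const_mx 1.
have [_ _ /(_ u)] := singular_values_spec A.
have -> : (u^T *m (A^T *m A) *m u) 0 0 = \sum_i (\sum_j A i j) ^+ 2.
  rewrite mulmxA -trmx_mul -mulmxA mxE; apply: eq_bigr => i _.
  rewrite mxE expr2 (_ : (A *m u) i 0 = \sum_j A i j) // mxE.
  by apply: eq_bigr => j _; rewrite mxE mulr1.
have -> : (u^T *m u) 0 0 = n%:R.
  rewrite mxE; under eq_bigr => i _ do rewrite !mxE mulr1.
  by rewrite sumr_const card_ord.
move=> sumr; rewrite -mulrA [n%:R * _]mulrC.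
apply: le_trans (ler_wpM2l (ler0n _ m) sumr); exact: sqr_sum_le.
Qed.

(** * The bound *)

Lemma ler_mx_norm_entry (R : realDomainType) m n (A : 'M[R]_(m, n)) i j :
  `|A i j| <= mx_norm A.
Proof.
by rewrite mx_normrE (le_bigmax _ (fun ij => `|A ij.1 ij.2|) (i, j)).
Qed.

Theorem theorem5 (R : realType) (k m n : nat) (A : 'M[R]_(m, n))
    (k_ge2 : (2 <= k)%N) (k_le_m : (k <= m)%N) (m_le_n : (m <= n)%N)
    (A_ge0 : forall i j, 0 <= A i j)
    (A_le1 : mx_norm A <= 1) :
  ky_fan_norm k A + ky_fan_norm k (const_mx 1 - A)
    <= Num.sqrt (m%:R * n%:R) * (1 + Num.sqrt (k%:R - 1)).
Proof.
case: k k_ge2 k_le_m => // k k_gt0 k_lt_m; rewrite ltnS in k_gt0.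
have k_lt_n := leq_trans k_lt_m m_le_n.
rewrite [k.+1%:R]mulrSr addrK.
set B := const_mx 1 - A; set N := Num.sqrt (m%:R * n%:R).
set c := Num.sqrt k%:R.
have mn_gt0 : 0 < m%:R * n%:R :> R.
  by rewrite -natrM ltr0n muln_gt0 (leq_ltn_trans _ k_lt_m) //
    (leq_ltn_trans _ k_lt_n).
have N_gt0 : 0 < N by rewrite sqrtr_gt0.
have N2 : m%:R * n%:R = N ^+ 2 by rewrite sqr_sqrtr // ltW.
have c_ge1 : 1 <= c by rewrite -sqrtr1 ler_sqrt ?ler1n.
have c2 : k%:R = c ^+ 2 by rewrite sqr_sqrtr.
have N0 : N != 0 by rewrite gt_eqF.
have c0 : c != 0 by rewrite gt_eqF // (lt_le_trans ltr01).
have t_gt0 : 0 < c / N by rewrite divr_gt0 // (lt_le_trans ltr01).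
have sumB : \sum_i \sum_j B i j = N ^+ 2 - \sum_i \sum_j A i j.
  under eq_bigr => i _.
    under eq_bigr => j _ do rewrite !mxE.
    rewrite sumrB sumr_const card_ord; over.
  by rewrite sumrB sumr_const card_ord -N2 -mulrnA natrM [n%:R * _]mulrC.
have sqAB : \sum_i \sum_j A i j ^+ 2 + \sum_i \sum_j B i j ^+ 2 <= N ^+ 2.
  have -> : N ^+ 2 = \sum_(i < m) \sum_(j < n) 1.
    rewrite -N2; under eq_bigr => i _ do rewrite sumr_const card_ord.
    by rewrite sumr_const card_ord -mulrnA natrM mulrC.
  rewrite -big_split; apply: ler_sum => i _.
  rewrite -big_split; apply: ler_sum => j _.
  have := le_trans (ler_mx_norm_entry A i j) A_le1.
  rewrite ger0_norm // !mxE /=; have := A_ge0 i j; nra.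
have kfA := ky_fan_norm_le A k_lt_n t_gt0.
have kfB := ky_fan_norm_le B k_lt_n t_gt0.
have top (C : 'M[R]_(m, n)) : \sum_i \sum_j C i j <= N * (singular_values C)`_0.
  have N_sv0 := mulr_ge0 (ltW N_gt0) (singular_values_ge0 C 0).
  rewrite (le_trans (ler_norm _)) // -ler_sqr ?nnegrE //.
  by rewrite real_normK ?num_real // exprMn -N2 sum_entries_le.
have xy : N <= (singular_values A)`_0 + (singular_values B)`_0.
  rewrite -(ler_pM2l N_gt0) mulrDr -expr2.
  by have := lerD (top A) (top B); rewrite sumB subrKC.
set x := _`_0 in kfA xy; set y := _`_0 in kfB xy.
set a := \sum_i _ in kfA sqAB; set b := \sum_i _ in kfB sqAB.
apply: le_trans (lerD kfA kfB) _; rewrite c2.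
have -> : c ^+ 2 / (4 * (c / N)) = c * N / 4 by field; rewrite c0 N0.
rewrite -(ler_pM2l N_gt0) -subr_ge0.
set D := _ - _.
(* The identity x^2 + y^2 = (x + y)^2 / 2 + (x - y)^2 / 2 splits the difference
   of the two sides into nonnegative terms. *)
have -> : D = c * (N ^+ 2 - (a + b)) + c / 2 * (x - y) ^+ 2
   + (x + y - N) * (c * (x + y - N) / 2 + N * (c - 1)).
  by rewrite /D; field.
have c_ge0 : 0 <= c by rewrite (le_trans ler01).
apply: addr_ge0.
  apply: addr_ge0; first by rewrite mulr_ge0 ?subr_ge0.
  by rewrite mulr_ge0 ?divr_ge0 ?sqr_ge0 ?ler0n.
rewrite mulr_ge0 ?subr_ge0 // addr_ge0 //.
  by rewrite divr_ge0 ?mulr_ge0 ?subr_ge0 ?ler0n.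
by rewrite mulr_ge0 ?subr_ge0 // ltW.
Qed.
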